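(* Let $d\ge 1$ and $M\in S_d^+$, and let $\mathcal T$ be an $M$-reduced mesh. Let $\Lambda$ be the Hopf–Lax operator associated with $M$ and $\mathcal T$ (defined in the context). Then the fixed point problem $$\delta(z)=\Lambda(\delta,z)\ \ (z\in\mathbb Z^d\setminus\{0\}),\qquad \delta(0)=0$$ has a unique solution $\delta_M:\mathbb Z^d\to\mathbb R_+$, which can be obtained in one pass by the fast marching algorithm. Moreover, writing $D_M(z):=\|z\|_M$, one has for all $z\in\mathbb Z^d$ $$0\le \delta_M(z)-D_M(z)\le d\, r_M(\mathcal T)\Big(1+\ln^+\Big(\frac{D_M(z)}{r_M(\mathcal T)}\Big)\Big),$$ where $\ln^+(r):=\max\{\ln r,0\}$. More precisely, if $-z\in\mathbb R_+T:=\{rx;\ r\ge 0,\ x\in T\}$ for some $T\in\mathcal T$, then $$0\le \delta_M(z)-D_M(z)\le d\,(\sin\theta_M(T))^2\, r_M(T)\Big(1+\ln^+\Big(\frac{D_M(z)}{r_M(T)}\Big)\Big).$$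
   Context: $S_d^+$ is the set of $d\times d$ symmetric positive definite matrices. For $M\in S_d^+$ and $u,v\in\mathbb R^d$, $\langle u,v\rangle_M:=u^{T}Mv$ and $\|u\|_M:=\sqrt{\langle u,u\rangle_M}$. An $M$-reduced mesh is a finite conforming mesh $\mathcal T$ of simplices in $\mathbb R^d$ such that: (I) the union of its simplices is a neighborhood of the origin; (II) the vertices of each $T\in\mathcal T$ lie in $\mathbb Z^d$ and $T$ has volume $1/d!$; (III) each $T\in\mathcal T$ has the origin as a vertex, and its other vertices $v_1,\dots,v_d$ satisfy $\langle v_i,v_j\rangle_M\ge 0$ for all $1\le i,j\le d$. For $\delta:\mathbb Z^d\to\mathbb R_+\cup\{\infty\}$ and $z\in\mathbb Z^d$, the Hopf–Lax operator is $$\Lambda(\delta,z):=\min\Big\{\Big\|\sum_{i=1}^k\alpha_iv_i\Big\|_M+\sum_{i=1}^k\alpha_i\,\delta(z+v_i)\Big\},$$ the minimum being over $1\le k\le d$, $\alpha_1,\dots,\alpha_k\ge0$ with $\sum_i\alpha_i=1$, and non-zero vertices $v_1,\dots,v_k$ of a common simplex $T\in\mathcal T$; with the convention $0\times\infty=0$. For $T\in\mathcal T$: $r_M(T):=\max_{z\in T}\|z\|_M$, $r_M(\mathcal T):=\max_{T\in\mathcal T}r_M(T)$, and $\theta_M(T)\in[0,\pi]$ is defined by $\cos\theta_M(T):=\min_{u,v\in T\setminus\{0\}}\frac{\langle u,v\rangle_M}{\|u\|_M\|v\|_M}$. The fast marching algorithm computes the solution in one pass, i.e. it fixes the values at the points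 of $\mathbb Z^d$ one at a time in order of increasing value, each point being finalized once. *)

(* Defs.v *)
From mathcomp Require Import all_boot all_order all_algebra.
From mathcomp Require Import all_classical all_reals all_analysis.
Set Implicit Arguments. Unset Strict Implicit. Unset Printing Implicit Defensive.
Import Order.TTheory GRing.Theory Num.Theory.
Local Open Scope classical_set_scope.
Local Open Scope ring_scope.

Section FM.
Variables (R : realType) (d : nat).

Definition ivec (z : 'rV[int]_d) : 'rV[R]_d := map_mx (fun x : int => x%:~R) z.

Definition sym_posdef (M : 'M[R]_d) : Prop :=
  M^T = M /\ forall u : 'rV[R]_d, u != 0 -> 0 < (u *m M *m u^T) 0 0.

Definition innerM (M : 'M[R]_d) (u v : 'rV[R]_d) : R := (u *m M *m v^T) 0 0.
Definition normM (M : 'M[R]_d) (u : 'rV[R]_d) : R := Num.sqrt (innerM M u u).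

Definition conv (s : seq 'rV[R]_d) : set 'rV[R]_d :=
  [set x | exists lam : 'I_(size s) -> R,
     (forall i, 0 <= lam i) /\ \sum_i lam i = 1 /\
     x = \sum_i lam i *: s`_i].

(* A simplex having the origin as a vertex is encoded by the d x d integer
   matrix whose rows are its other vertices v_1, ..., v_d. *)
Definition verts (T : 'M[int]_d) : seq 'rV[R]_d :=
  0 :: [seq ivec (row i T) | i <- enum 'I_d].

Definition simplex (T : 'M[int]_d) : set 'rV[R]_d := conv (verts T).

Definition conforming (mesh : seq 'M[int]_d) : Prop :=
  forall T1 T2, T1 \in mesh -> T2 \in mesh ->
    simplex T1 `&` simplex T2 = conv [seq v <- verts T1 | v \in verts T2].

Definition M_reduced (M : 'M[R]_d) (mesh : seq 'M[int]_d) : Prop :=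
  conforming mesh /\
  (exists eps : R, 0 < eps /\ forall x : 'rV[R]_d,
      (forall i, `|x 0 i| < eps) -> exists2 T, T \in mesh & simplex T x) /\
  (* (II) integer vertices (built in) and volume |det| / d! = 1 / d! *)
  (forall T, T \in mesh -> `|(\det T)%:~R : R| / (d`!)%:R = 1 / (d`!)%:R) /\
  (* (III) origin is a vertex (built in) and acuteness *)
  (forall T, T \in mesh -> forall i j : 'I_d,
      0 <= innerM M (ivec (row i T)) (ivec (row j T))).

(* Hopf-Lax operator (0 * +oo = 0 holds in \bar R) *)
Definition HopfLax (M : 'M[R]_d) (mesh : seq 'M[int]_d)
    (delta : 'rV[int]_d -> \bar R) (z : 'rV[int]_d) : \bar R :=
  ereal_inf [set x : \bar R | exists T, T \in mesh /\
    exists (k : nat) (f : 'I_k -> 'I_d) (a : 'I_k -> R),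
      [/\ (0 < k <= d)%N, (forall i, 0 <= a i), \sum_i a i = 1 &
       x = ((normM M (\sum_i a i *: ivec (row (f i) T)))%:E +
            \sum_(i < k) (a i)%:E * delta (z + row (f i) T)%R)%E]].

Definition is_solution (M : 'M[R]_d) (mesh : seq 'M[int]_d)
    (delta : 'rV[int]_d -> \bar R) : Prop :=
  delta 0 = 0%E /\ forall z, z != 0 -> delta z = HopfLax M mesh delta z.

(* The fast marching algorithm computes delta in one pass: some run of it
   finalizes the points sigma 0 = 0, sigma 1, sigma 2, ... (each point of Z^d
   exactly once); at step n the tentative value of an unfixed point y is the
   Hopf-Lax update using only the values fixed so far (+oo elsewhere), the point
   sigma n is a minimizer of the tentative values, and the value thus fixed is
   the true solution value. *)
Definition fixed_before (sigma : nat -> 'rV[int]_d) (n : nat)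
    (delta : 'rV[int]_d -> \bar R) : 'rV[int]_d -> \bar R :=
  fun y => if y \in [seq sigma i | i <- iota 0 n] then delta y else +oo%E.

Definition fast_marching_one_pass (M : 'M[R]_d) (mesh : seq 'M[int]_d)
    (delta : 'rV[int]_d -> \bar R) : Prop :=
  exists sigma : nat -> 'rV[int]_d,
    bijective sigma /\ sigma 0%N = 0 /\
    forall n, (0 < n)%N ->
      delta (sigma n) = HopfLax M mesh (fixed_before sigma n delta) (sigma n) /\
      forall m, (n <= m)%N ->
        (delta (sigma n) <= HopfLax M mesh (fixed_before sigma n delta) (sigma m))%E.

Definition rM_simplex (M : 'M[R]_d) (T : 'M[int]_d) : R :=
  sup [set normM M x | x in simplex T].
Definition rM_mesh (M : 'M[R]_d) (mesh : seq 'M[int]_d) : R :=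
  \big[Num.max/0]_(T <- mesh) rM_simplex M T.

Definition cos_thetaM (M : 'M[R]_d) (T : 'M[int]_d) : R :=
  inf [set c | exists u v, [/\ simplex T u, u != 0, simplex T v, v != 0 &
                   c = innerM M u v / (normM M u * normM M v)]].
Definition thetaM (M : 'M[R]_d) (T : 'M[int]_d) : R := acos (cos_thetaM M T).

Definition lnplus (r : R) : R := if r <= 1 then 0 else ln r.

Definition cone (T : 'M[int]_d) : set 'rV[R]_d :=
  [set y | exists r x, 0 <= r /\ simplex T x /\ y = r *: x].

End FM.
Arguments ivec {R d} z.

(* Main.v *)
Require Import Defs.
From mathcomp Require Import all_boot all_order all_algebra.
From mathcomp Require Import all_classical all_reals all_analysis.
From mathcomp Require Import ring lra.
Set Implicit Arguments. Unset Strict Implicit. Unset Printing Implicit Defensive.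
Import Order.TTheory GRing.Theory Num.Theory.
Import numFieldNormedType.Exports.
Local Open Scope classical_set_scope.
Local Open Scope ring_scope.

(* Acuteness yields causality: if the weights [a] attain the Hopf-Lax minimum at
   [z], then [delta (z + v_i) < delta z] whenever [a_i <> 0], and one of these
   values drops by a uniform amount.  Hence a solution has finite sublevel sets,
   and induction along its values shows that it dominates every subsolution.
   This gives uniqueness, the lower bound by the convex function [D_M], and the
   one-pass property; existence is the Knaster-Tarski theorem.
   For the upper bound, unimodularity gives [- z = \sum_i n_i v_i] with natural
   [n_i].  Moving with the weights [n_i / \sum_j n_j] stays in the cone and heads
   straight to the origin; the excess of [\sum_i a_i D_M (z + v_i)] over
   [D_M (z + \sum_i a_i v_i)] is paid by the decrease of a concave function of
   [D_M] which is linear on [[0, r]] and logarithmic beyond. *)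

(** * The norm of a positive definite matrix *)

Section InnerProduct.
Variables (R : realType) (d : nat) (M : 'M[R]_d).
Hypothesis hM : sym_posdef M.
Local Notation inner := (innerM M).
Local Notation norm := (normM M).
Implicit Types u v w : 'rV[R]_d.

Lemma innerMC u v : inner u v = inner v u.
Proof.
rewrite /innerM; have [Ms _] := hM.
by rewrite -[u *m M *m v^T]trmxK mxE !trmx_mul trmxK Ms mulmxA.
Qed.

Lemma innerMDl u v w : inner (u + v) w = inner u w + inner v w.
Proof. by rewrite /innerM !mulmxDl mxE. Qed.

Lemma innerMZl a u w : inner (a *: u) w = a * inner u w.
Proof. by rewrite /innerM -!scalemxAl mxE. Qed.

Lemma innerMDr u v w : inner w (u + v) = inner w u + inner w v.
Proof. by rewrite !(innerMC w) innerMDl. Qed.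

Lemma innerMZr a u w : inner w (a *: u) = a * inner w u.
Proof. by rewrite !(innerMC w) innerMZl. Qed.

Lemma innerMNl u w : inner (- u) w = - inner u w.
Proof. by rewrite -scaleN1r innerMZl mulN1r. Qed.

Lemma innerMNr u w : inner w (- u) = - inner w u.
Proof. by rewrite !(innerMC w) innerMNl. Qed.

Lemma innerM0l w : inner 0 w = 0.
Proof. by rewrite /innerM !mul0mx mxE. Qed.

Lemma innerM_suml (I : finType) (F : I -> 'rV[R]_d) w :
  inner (\sum_i F i) w = \sum_i inner (F i) w.
Proof. by rewrite /innerM !mulmx_suml summxE. Qed.

Lemma innerM_sumr (I : finType) (F : I -> 'rV[R]_d) w :
  inner w (\sum_i F i) = \sum_i inner w (F i).
Proof. by rewrite innerMC innerM_suml; apply: eq_bigr => i _; rewrite innerMC. Qed.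

Lemma innerM_gt0 u : u != 0 -> 0 < inner u u.
Proof. by have [_] := hM; exact. Qed.

Lemma innerM_ge0 u : 0 <= inner u u.
Proof.
by have [->|/innerM_gt0/ltW//] := eqVneq u 0; rewrite innerM0l.
Qed.

Lemma sqr_normM u : norm u ^+ 2 = inner u u.
Proof. by rewrite /normM sqr_sqrtr ?innerM_ge0. Qed.

Lemma normM_ge0 u : 0 <= norm u.
Proof. exact: sqrtr_ge0. Qed.

Lemma normM_gt0 u : u != 0 -> 0 < norm u.
Proof. by move=> u0; rewrite sqrtr_gt0 innerM_gt0. Qed.

Lemma normM0 : norm 0 = 0.
Proof. by rewrite /normM innerM0l sqrtr0. Qed.

Lemma normMZ a u : 0 <= a -> norm (a *: u) = a * norm u.
Proof.
move=> a0; rewrite /normM innerMZl innerMZr mulrA -expr2 sqrtrM ?sqr_ge0//.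
by rewrite sqrtr_sqr ger0_norm.
Qed.

Lemma normMN u : norm (- u) = norm u.
Proof. by rewrite /normM innerMNl innerMNr opprK. Qed.

Lemma sqr_innerM_le u v : inner u v ^+ 2 <= inner u u * inner v v.
Proof.
have [->|v0] := eqVneq v 0; first by rewrite innerMC !innerM0l expr0n mulr0.
have vv := innerM_gt0 v0.
(* This vector is [inner v v] times the component of [u] orthogonal to [v]; its square is
   [c * (a * c - b ^+ 2)]. *)
have := innerM_ge0 (inner v v *: u - inner u v *: v).
rewrite !(innerMDl, innerMDr, innerMNl, innerMNr, innerMZl, innerMZr).
rewrite (innerMC v u); set a := inner u u; set b := inner u v.
set c := inner v v => h.
have : 0 <= c * (a * c - b ^+ 2) by nra.
by rewrite pmulr_rge0// subr_ge0.
Qed.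

Lemma innerM_le u v : inner u v <= norm u * norm v.
Proof.
have := sqr_innerM_le u v; rewrite -!sqr_normM -exprMn => h.
apply: (le_trans (ler_norm _)); rewrite -ler_sqr ?nnegrE ?mulr_ge0 ?normM_ge0//.
by rewrite real_normK ?num_real.
Qed.

Lemma normMD u v : norm (u + v) <= norm u + norm v.
Proof.
rewrite -ler_sqr ?nnegrE ?addr_ge0 ?normM_ge0// sqr_normM.
rewrite innerMDl !innerMDr (innerMC v u) -!sqr_normM.
by have := innerM_le u v; nra.
Qed.

Lemma normM_sum (I : finType) (F : I -> 'rV[R]_d) :
  norm (\sum_i F i) <= \sum_i norm (F i).
Proof.
elim/big_rec2: _ => [|i y x _ h]; first by rewrite normM0.
by rewrite (le_trans (normMD _ _))// lerD2l.
Qed.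

Lemma normM_comb (I : finType) (a : I -> R) (F : I -> 'rV[R]_d) :
  (forall i, 0 <= a i) -> norm (\sum_i a i *: F i) <= \sum_i a i * norm (F i).
Proof.
move=> a0; apply: (le_trans (normM_sum _)); apply: ler_sum => i _.
by rewrite normMZ.
Qed.

End InnerProduct.

(** * Scalar inequalities behind the error bound *)

Section Potential.
Variable R : realType.
Implicit Types x y t : R.

(* The C^1 concave modification, below 1, of the function [1 + ln]. *)
Definition potential x : R := if x <= 1 then x else 1 + ln x.

Lemma ln_le_sub1 x : 0 < x -> ln x <= x - 1.
Proof. by move=> x0; have := @le_ln1Dx R (x - 1); rewrite addrCA subrr addr0; apply; lra. Qed.

Lemma potential_le x : 0 <= x -> potential x <= 1 + lnplus x.
Proof. by rewrite /potential /lnplus; case: ifP; rewrite ?addr0. Qed.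

Lemma potential_ge0 x : 0 <= x -> 0 <= potential x.
Proof.
rewrite /potential; have [//|x1 _] := leP x 1.
by rewrite addr_ge0// ln_ge0// ltW.
Qed.

(** A concave function lies below its tangents, and the slope at [t] is [Num.min 1 t^-1]. All cases
    reduce to [ln x <= x - 1], taken at [y], [t^-1] or [t^-1 * y]. *)
Lemma potential_tangent t y : 0 < t -> 0 <= y ->
  potential y <= potential t + Num.min 1 t^-1 * (y - t).
Proof.
move=> t0 y0; rewrite /potential.
have [t1|t1] := leP t 1.
  rewrite (min_idPl _) ?invf_ge1// mul1r addrCA subrr addr0.
  by have [//|y1] := leP y 1; have := @ln_le_sub1 y; lra.
rewrite (min_idPr _); last by rewrite invf_le1 // ltW.
have ti : t^-1 * t = 1 by rewrite mulVf // gt_eqF.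
have ti0 : 0 < t^-1 by rewrite invr_gt0.
have [y1|y1] := leP y 1.
  have : ln t^-1 <= t^-1 - 1 by exact: ln_le_sub1.
  rewrite lnV ?posrE// mulrBr ti => h.
  have : t^-1 * y - y - t^-1 + 1 >= 0 by nra.
  lra.
have y0' : 0 < y by lra.
have := @ln_le_sub1 (t^-1 * y) (mulr_gt0 ti0 y0').
rewrite lnM ?posrE// lnV ?posrE// mulrBr ti; lra.
Qed.

(* The triangle with sides [D], [D'], [v] has inner product [q] between [D] and
   [v]; the Gram inequality says that the sine of its angle opposite to [D] is
   at most [sqrt S]. *)
Lemma triangle_excess (D D' v q S : R) : 0 < D -> 0 <= D' -> 0 <= v -> 0 <= S ->
  D' ^+ 2 = D ^+ 2 - 2 * q + v ^+ 2 -> v ^+ 2 <= q -> q <= v * D ->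
  D ^+ 2 * v ^+ 2 - q ^+ 2 <= S * (v ^+ 2 * D' ^+ 2) ->
  D' - D + q / D <= q / D / 2 /\ D' - D + q / D <= S * v ^+ 2 / D / 2.
Proof.
move=> D0 D'0 v0 S0 e h1 h2 gram.
set p := q / D.
have qE : q = p * D by rewrite /p divfK // gt_eqF.
have p0 : 0 <= p by rewrite divr_ge0 ?(ltW D0)//; nra.
have pv : p <= v by rewrite ler_pdivrMr.
have vD : v <= D.
  have [->|vn0] := eqVneq v 0; first exact: ltW.
  have vp : 0 < v by rewrite lt_def vn0.
  by rewrite -(ler_pM2l vp) -expr2 (le_trans h1).
(* From [v ^+ 2 <= q] follows [D' ^+ 2 <= D ^+ 2 - p * D <= (D - p / 2) ^+ 2]. *)
have D'le : D' <= D - p / 2.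
  rewrite -ler_sqr ?nnegrE; nra.
split; first lra.
set c := D' - D + p.
(* Multiplying [c] by its conjugate gives [D' ^+ 2 - (D - p) ^+ 2 = v ^+ 2 - p ^+ 2], which is the
   Gram determinant divided by [D ^+ 2]. *)
have cE : c * (D' + D - p) * D ^+ 2 <= S * v ^+ 2 * D' ^+ 2.
  apply: le_trans (_ : D ^+ 2 * v ^+ 2 - q ^+ 2 <= _); last by rewrite -mulrA.
  have -> // : c * (D' + D - p) * D ^+ 2 = D ^+ 2 * v ^+ 2 - q ^+ 2.
  have -> : c * (D' + D - p) = D' ^+ 2 - (D - p) ^+ 2 by rewrite /c; ring.
  by rewrite e qE; ring.
rewrite ler_pdivlMr// ler_pdivlMr//.
have Sv : 0 <= S * v ^+ 2 by rewrite mulr_ge0 ?sqr_ge0.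
have [s0|s0] := leP (D' + D - p) 0.
  have c0 : c <= 0 by rewrite /c; lra.
  by apply: le_trans Sv; rewrite mulr_le0_ge0 ?(ltW D0) //; lra.
(* This trades the factor [D' ^+ 2] of the Gram bound for the conjugate [D' + D - p], which then
   cancels and leaves the factor 1/2. *)
have D'2 : 2 * D' ^+ 2 <= (D' + D - p) * D.
  have : 0 <= (D - p / 2 - D') * (2 * D' + D - p) by apply: mulr_ge0; lra.
  have : 0 <= p * (D - p) by apply: mulr_ge0; lra.
  nra.
have hh : 2 * (c * (D' + D - p) * D ^+ 2) <= S * v ^+ 2 * ((D' + D - p) * D).
  apply: le_trans (_ : S * v ^+ 2 * (2 * D' ^+ 2) <= _); last exact: ler_wpM2l.
  by lra.
have sD : 0 < (D' + D - p) * D by rewrite mulr_gt0.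
rewrite -(ler_pM2r sD); apply: le_trans hh; rewrite le_eqVlt; apply/orP; left.
by apply/eqP; ring.
Qed.

End Potential.

(** * The Hopf-Lax operator *)

Section IntegerVectors.
Variables (R : realType) (d : nat).
Implicit Types z w : 'rV[int]_d.

Lemma ivec0 : ivec 0 = 0 :> 'rV[R]_d.
Proof. by rewrite /ivec map_mx0. Qed.

Lemma ivecD z w : ivec (z + w) = ivec z + ivec w :> 'rV[R]_d.
Proof. by rewrite /ivec map_mxD. Qed.

Lemma ivecN z : ivec (- z) = - ivec z :> 'rV[R]_d.
Proof. by rewrite /ivec map_mxN. Qed.

Lemma ivecMn z n : ivec (z *+ n) = n%:R *: ivec z :> 'rV[R]_d.
Proof.
elim: n => [|n IH]; first by rewrite mulr0n scale0r ivec0.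
by rewrite mulrS ivecD IH -nat1r scalerDl scale1r.
Qed.

Lemma ivec_sum (I : finType) (F : I -> 'rV[int]_d) :
  ivec (\sum_i F i) = \sum_i ivec (F i) :> 'rV[R]_d.
Proof. by rewrite (big_morph _ ivecD ivec0). Qed.

Lemma ivec_mul z (T : 'M[int]_d) :
  ivec (z *m T) = \sum_i (z 0 i)%:~R *: ivec (row i T) :> 'rV[R]_d.
Proof.
rewrite mulmx_sum_row ivec_sum; apply: eq_bigr => i _.
by apply/rowP => j; rewrite !mxE rmorphM.
Qed.

End IntegerVectors.

Definition weights (R : realType) (d : nat) (a : 'I_d -> R) : Prop :=
  (forall i, 0 <= a i) /\ \sum_i a i = 1.

Section HopfLaxOperator.
Variables (R : realType) (d : nat) (M : 'M[R]_d) (mesh : seq 'M[int]_d).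
Hypothesis hM : sym_posdef M.
Local Notation norm := (normM M).
Local Notation vtx T i := (ivec (row i T) : 'rV[R]_d).

(** Weights on all [d] vertices, possibly zero, replace the choice of [k] vertices in [HopfLax]. *)
Definition update_cost (delta : 'rV[int]_d -> R) (z : 'rV[int]_d)
    (T : 'M[int]_d) (a : 'I_d -> R) : R :=
  norm (\sum_i a i *: vtx T i) + \sum_i a i * delta (z + row i T).

Lemma HopfLax_le_cost (delta : 'rV[int]_d -> \bar R) z T a :
  T \in mesh -> weights a ->
  (HopfLax M mesh delta z <=
    (norm (\sum_i a i *: vtx T i))%:E + \sum_i (a i)%:E * delta (z + row i T)%R)%E.
Proof.
move=> Tm [a0 a1]; apply: ereal_inf_lbound; exists T; split => //.
(* All vertices are taken; [d] is positive because an empty sum cannot equal 1. *)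
exists d, id, a; split => //; rewrite leqnn andbT lt0n; apply/eqP => d0.
move/eqP: a1; rewrite big1 ?(eq_sym 0) ?oner_eq0// => -[i hi] _.
by exfalso; move: hi; rewrite {1}d0.
Qed.

Lemma HopfLax_le_update (delta : 'rV[int]_d -> R) z T a :
  T \in mesh -> weights a ->
  (HopfLax M mesh (EFin \o delta) z <= (update_cost delta z T a)%:E)%E.
Proof.
move=> Tm wa; apply: le_trans (HopfLax_le_cost _ _ Tm wa) _.
by rewrite /update_cost EFinD -sumEFin.
Qed.

Lemma le_HopfLax (delta delta' : 'rV[int]_d -> \bar R) z :
  (forall y, delta y <= delta' y)%E ->
  (HopfLax M mesh delta z <= HopfLax M mesh delta' z)%E.
Proof.
move=> le; apply: le_ereal_inf_tmp => x [T [Tm [k [f [a [kd a0 a1 ->]]]]]].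
apply: ge_ereal_inf; eexists; first by exists T; split => //; exists k, f, a.
by rewrite leeD2l// lee_sum// => i _; rewrite lee_wpmul2l ?lee_fin.
Qed.

Lemma HopfLax_ge0 (delta : 'rV[int]_d -> \bar R) z :
  (forall y, 0 <= delta y)%E -> (0 <= HopfLax M mesh delta z)%E.
Proof.
move=> d0; apply: le_ereal_inf_tmp => x [T [Tm [k [f [a [kd a0 a1 ->]]]]]].
rewrite adde_ge0 ?lee_fin ?normM_ge0// sume_ge0// => i _.
by rewrite mule_ge0 ?lee_fin.
Qed.

Lemma HopfLax_ge (delta : 'rV[int]_d -> R) z (x : \bar R) :
  (forall T a, T \in mesh -> weights a -> (x <= (update_cost delta z T a)%:E)%E) ->
  (x <= HopfLax M mesh (EFin \o delta) z)%E.
Proof.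
move=> h; apply: le_ereal_inf_tmp => _ [T [Tm [k [f [a [kd a0 a1 ->]]]]]].
(* The map [f] may repeat vertices; pushing the weights forward along [f] changes neither sum. *)
pose b j := \sum_(i | f i == j) a i.
have wb : weights b.
  split; first by move=> j; apply: sumr_ge0.
  by rewrite -a1 [RHS](partition_big f xpredT).
apply: le_trans (h T b Tm wb) _.
under [X in (_ + X)%E]eq_bigr do rewrite /= -EFinM.
rewrite sumEFin -EFinD lee_fin /update_cost.
rewrite [in leRHS](partition_big f xpredT)//=.
rewrite [X in _ <= _ + X](partition_big f xpredT)//=.
rewrite le_eqVlt; apply/orP; left; apply/eqP; congr (norm _ + _).
  by apply: eq_bigr => j _; rewrite scaler_suml; apply: eq_bigr => i /eqP ->.
by apply: eq_bigr => j _; rewrite mulr_suml; apply: eq_bigr => i /eqP ->.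
Qed.

Lemma continuous_sum (T : topologicalType) (I : finType) (F : I -> T -> R) :
  (forall i, continuous (F i)) -> continuous (fun x => \sum_i F i x).
Proof.
move=> cF; apply: continuous_big => // x; exact: add_continuous.
Qed.

Lemma continuous_mul (T : topologicalType) (f g : T -> R) :
  continuous f -> continuous g -> continuous (fun x => f x * g x).
Proof. by move=> cf cg x; apply: cvgM; [exact: cf|exact: cg]. Qed.

(** The cost is continuous on the set of weights, which is compact as a closed subset of the unit
    cube. *)
Lemma update_cost_min delta z T : (0 < d)%N ->
  exists2 a, weights a &
    forall b, weights b -> update_cost delta z T a <= update_cost delta z T b.
Proof.
move=> d0.
pose A := [set v : 'rV[R]_d | weights (v 0)].
pose F (v : 'rV[R]_d) := update_cost delta z T (v 0).
have [|||v vA vmin] := @compact_EVT_min _ R F A.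
- exists (\row_i (i == Ordinal d0)%:R); split => [i|]; first by rewrite mxE.
  under eq_bigr do rewrite mxE.
  by rewrite (bigD1 (Ordinal d0))// eqxx big1 => [|i /negPf ->//]; rewrite /= addr0.
- pose B := [set v : 'rV[R]_d | forall i, `[0, 1]%classic (v ord0 i)].
  have cB : compact B.
    by apply: (@rV_compact R d (fun=> `[0, 1]%classic)) => i; exact: segment_compact.
  apply: (subclosed_compact _ cB).
    have -> : A = \bigcap_(i in [set: 'I_d]) ((fun v => v 0 i) @^-1` [set x : R | 0 <= x]) `&`
        ((fun v => \sum_i v 0 i) @^-1` [set 1]).
      apply/seteqP; split => v /=; first by move=> [h1 h2]; split => // i _; exact: h1.
      by move=> [h1 h2]; split => // i; exact: h1.
    apply: closedI.
      apply: closed_bigI => i _; move/continuous_closedP: (@coord_continuous R 1 d 0 i); apply.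
      exact: closed_ge.
    have /continuous_closedP : continuous (fun v : 'rV[R]_d => \sum_i v 0 i).
      by apply: continuous_sum => i; exact: coord_continuous.
    by apply; exact: closed_eq.
  move=> v [v0 v1] i /=; rewrite in_itv/= v0 -v1 (bigD1 i)//= lerDl.
  by apply: sumr_ge0.
- apply: continuous_subspaceT.
  pose V (v : 'rV[R]_d) := \sum_i v 0 i *: vtx T i.
  have cV : continuous (fun v => innerM M (V v) (V v)).
    have -> : (fun v => innerM M (V v) (V v)) =
        (fun v => \sum_i \sum_j v 0 i * (v 0 j * innerM M (vtx T i) (vtx T j))).
      apply/funext => w; rewrite innerM_suml; apply: eq_bigr => i _.
      by rewrite innerM_sumr//; apply: eq_bigr => j _; rewrite innerMZl innerMZr.
    apply: continuous_sum => i; apply: continuous_sum => j.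
    apply: continuous_mul; first exact: coord_continuous.
    by apply: continuous_mul; [exact: coord_continuous|exact: cst_continuous].
  have cd : continuous (fun v : 'rV[R]_d => \sum_i v 0 i * delta (z + row i T)).
    apply: continuous_sum => i.
    by apply: continuous_mul; [exact: coord_continuous|exact: cst_continuous].
  move=> v; apply: cvgD (cd v).
  exact: (continuous_comp (cV v) (@sqrt_continuous R _)).
exists (v 0); first by move: vA; rewrite inE.
move=> b wb; have -> : b = (\row_i b i) 0 by apply/funext => i; rewrite mxE.
apply: vmin; rewrite inE /A /=.
by have -> : (\row_i b i) 0 = b by apply/funext => i; rewrite mxE.
Qed.

End HopfLaxOperator.

Lemma seq_argmin (R : realDomainType) (T : eqType) (s : seq T) (f : T -> R) x0 :
  x0 \in s -> exists2 x, x \in s & forall y, y \in s -> f x <= f y.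
Proof.
elim: s x0 => // x s IH x0 _; case: s IH => [_|y s IH].
  by exists x; rewrite ?mem_head// => y; rewrite inE => /eqP ->.
have [m ms mmin] := IH y (mem_head _ _).
have [le|/ltW le] := leP (f x) (f m).
  exists x; rewrite ?mem_head// => t; rewrite inE => /orP[/eqP->//|/mmin].
  exact: le_trans.
exists m; first by rewrite inE ms orbT.
by move=> t; rewrite inE => /orP[/eqP->//|/mmin].
Qed.

(** * Enumeration by increasing value *)

Section FinalizationOrder.
Variables (R : realDomainType) (T : countType) (f : T -> R).
Hypothesis finite_sublevel : forall b, exists s : seq T, forall x, f x <= b -> x \in s.

(** Ties in value are broken by the encoding of the countable type, so that the order is total. *)
Let lt x y := (f x < f y) || (f x == f y) && (pickle x < pickle y)%N.

Let lt_trans : transitive lt.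
Proof.
rewrite /lt => y x z /orP[xy|/andP[/eqP xy pxy]] /orP[yz|/andP[/eqP yz pyz]].
- by rewrite (lt_trans xy yz).
- by rewrite -yz xy.
- by rewrite xy yz.
- by rewrite xy yz eqxx (ltn_trans pxy pyz) orbT.
Qed.

Let lt_irr x : lt x x = false.
Proof. by rewrite /lt ltxx ltnn andbF. Qed.

Let lt_total x y : x != y -> lt x y || lt y x.
Proof.
move=> xy; rewrite /lt; case: ltgtP => //= _.
by case: ltngtP => // /(pcan_inj pickleK) /eqP; rewrite (negPf xy).
Qed.

Let below x : {s : seq T | uniq s & forall y, (y \in s) = lt y x}.
Proof.
have [s hs] := cid (finite_sublevel (f x)).
exists (undup [seq y <- s | lt y x]) => [|y]; first exact: undup_uniq.
rewrite mem_undup mem_filter; case: (boolP (lt y x)) => //= yx; apply: hs.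
by case/orP: yx => [/ltW//|/andP[/eqP->]].
Qed.

Let rank x := size (s2val (below x)).

Let rank_mono x y : lt x y -> (rank x < rank y)%N.
Proof.
move=> xy; rewrite /rank; case: (below x) => s us ms; case: (below y) => t ut mt /=.
apply: (@uniq_leq_size _ (x :: s)) => [|z] /=; first by rewrite ms lt_irr.
rewrite inE mt => /orP[/eqP->//|]; rewrite ms => zx; exact: lt_trans xy.
Qed.

Let rank_inj : injective rank.
Proof.
move=> x y e; apply/eqP/negPn/negP => /lt_total/orP[] /rank_mono;
  by rewrite e ltnn.
Qed.

Let rank_down x n : (n < rank x)%N -> exists y, rank y = n.
Proof.
move=> nx; set s := s2val (below x).
have [us ms] : uniq s /\ forall y, (y \in s) = lt y x by rewrite /s; case: (below x).
have [|k||_ e] := @uniq_min_size _ (map rank s) (iota 0 (rank x)).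
- by rewrite map_inj_uniq.
- move=> /mapP[y]; rewrite ms => yx ->; rewrite mem_iota; exact: rank_mono.
- by rewrite size_iota size_map.
have : n \in map rank s by rewrite e mem_iota.
by move=> /mapP[y _ ->]; exists y.
Qed.

Lemma sublevel_induction (P : T -> Prop) :
  (forall x, (forall y, f y < f x -> P y) -> P x) -> forall x, P x.
Proof.
move=> ind x; move: {2}(rank x).+1 (ltnSn (rank x)) => n.
elim: n x => // n IH x xn; apply: ind => y yx; apply: IH.
by apply: leq_trans (rank_mono _) xn; rewrite /lt yx.
Qed.

(** The injection [g] makes [T] infinite, so [rank] is unbounded and therefore onto; [sigma] is its
    inverse. *)
Lemma increasing_enumeration (g : nat -> T) : injective g ->
  exists2 sigma : nat -> T, bijective sigma &
    forall m n, (f (sigma m) < f (sigma n) -> (m < n)%N) /\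
                ((m <= n)%N -> f (sigma m) <= f (sigma n)).
Proof.
move=> ginj.
have sur n : exists x, rank x = n.
  suff [k nk] : exists k, (n < rank (g k))%N by apply: rank_down nk.
  apply/not_existsP => small.
  (* Pigeonhole: [n.+2] distinct ranks cannot all be at most [n]. *)
  have := @uniq_leq_size _ [seq rank (g k) | k <- iota 0 n.+2] (iota 0 n.+1).
  rewrite size_map !size_iota ltnn => H.
  suff : false by [].
  apply: H => [|k /mapP[m _ ->]]; last first.
    by rewrite mem_iota /= ltnS leqNgt; apply/negP; exact: small.
  by rewrite map_inj_uniq ?iota_uniq// => a b /rank_inj/ginj.
pose sigma n := proj1_sig (cid (sur n)).
have sigmaK n : rank (sigma n) = n by rewrite /sigma; case: cid.
exists sigma.
  by exists rank => // x; apply: rank_inj; rewrite sigmaK.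
move=> m n; split.
  by move=> mn; rewrite -[m]sigmaK -[n]sigmaK; apply: rank_mono; rewrite /lt mn.
move=> mn; rewrite leNgt; apply/negP => nm.
have : (n < m)%N by rewrite -[m]sigmaK -[n]sigmaK; apply: rank_mono; rewrite /lt nm.
by rewrite ltnNge mn.
Qed.

End FinalizationOrder.

(** * Causality and uniqueness *)

Section ReducedMesh.
Variables (R : realType) (d : nat) (M : 'M[R]_d) (mesh : seq 'M[int]_d).
Hypotheses (d_gt0 : (0 < d)%N) (hM : sym_posdef M) (hmesh : M_reduced M mesh).
Local Notation inner := (innerM M).
Local Notation norm := (normM M).
Local Notation vtx T i := (ivec (row i T) : 'rV[R]_d).
Implicit Types (T : 'M[int]_d) (z : 'rV[int]_d).

(** * Geometry of unimodular acute simplices and their cones *)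

Lemma mesh_unit T : T \in mesh -> T \in unitmx.
Proof.
have [_ [_ [vol _]]] := hmesh => /vol.
move/(divIf _); rewrite pnatr_eq0 -lt0n fact_gt0 => /(_ isT) h.
have /eqP : `|\det T| = 1 by apply: (@intr_inj R); rewrite intr_norm h.
by rewrite unitmxE unitrE; case: (\det T) => [[|[|n]]|[|n]].
Qed.

Lemma mesh_acute T i j : T \in mesh -> 0 <= inner (vtx T i) (vtx T j).
Proof. by move=> Tm; have [_ [_ [_ acute]]] := hmesh; exact: acute. Qed.

Lemma ivec_eq0 z : (ivec z == 0 :> 'rV[R]_d) = (z == 0).
Proof.
apply/eqP/eqP => [e|->]; last exact: ivec0.
by apply/rowP => i; move/rowP/(_ i): e; rewrite !mxE => /eqP; rewrite intr_eq0 => /eqP.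
Qed.

Lemma vtx_neq0 T i : T \in mesh -> vtx T i != 0.
Proof.
move=> /mesh_unit Tu; rewrite ivec_eq0; apply/eqP => r0.
have : row i T *m invmx T = row i 1%:M by rewrite -row_mul mulmxV.
rewrite r0 mul0mx => /rowP/(_ i); rewrite !mxE eqxx => /eqP.
by rewrite eq_sym oner_eq0.
Qed.

Lemma vtx_gt0 T i : T \in mesh -> 0 < norm (vtx T i).
Proof. by move=> Tm; rewrite normM_gt0 ?vtx_neq0. Qed.

(** The weight of the origin contributes nothing to [x]; dropping it turns the equality of total
    mass into an inequality. *)
Lemma convP T (x : 'rV[R]_d) : simplex T x <-> exists a : 'I_d -> R,
  [/\ forall i, 0 <= a i, \sum_i a i <= 1 & x = \sum_i a i *: vtx T i].
Proof.
rewrite /simplex /conv /verts /=; set t := [seq _ | i <- _].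
have e : d = size t by rewrite size_map size_enum_ord.
have tE (j : 'I_d) : t`_j = vtx T j.
  by rewrite (nth_map j) ?size_enum_ord// nth_ord_enum.
have castb : bijective (cast_ord e).
  by exists (cast_ord (esym e)) => i; rewrite ?cast_ordK ?cast_ordKV.
split=> [[lam [lam0 [lam1 ->]]]|[a [a0 a1 ->]]].
  exists (fun j => lam (lift ord0 (cast_ord e j))); split => //.
    rewrite -lam1 big_ord_recl (reindex (cast_ord e)) ?lerDr//.
    exact: onW_bij.
  rewrite big_ord_recl scaler0 add0r (reindex (cast_ord e)); last exact: onW_bij.
  by apply: eq_bigr => j _; rewrite -tE.
exists (fun i => if unlift ord0 i is Some k then a (cast_ord (esym e) k) else 1 - \sum_j a j).
split; first by move=> i; case: unlift => //; rewrite subr_ge0.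
split.
  rewrite big_ord_recl unlift_none (reindex (cast_ord e)); last exact: onW_bij.
  under eq_bigr do rewrite liftK cast_ordK.
  by rewrite subrK.
rewrite big_ord_recl scaler0 add0r (reindex (cast_ord e)); last exact: onW_bij.
by apply: eq_bigr => j _; rewrite liftK cast_ordK -tE.
Qed.

Lemma vtx_comb_inj T (b c : 'I_d -> R) : T \in mesh ->
  \sum_i b i *: vtx T i = \sum_i c i *: vtx T i -> forall i, b i = c i.
Proof.
move=> /mesh_unit Tu.
have combE (a : 'I_d -> R) : \sum_i a i *: vtx T i = (\row_i a i) *m map_mx intr T.
  by rewrite mulmx_sum_row; apply: eq_bigr => i _; rewrite mxE /ivec map_row.
rewrite !combE => /(congr1 (mulmx^~ (map_mx intr (invmx T)))).
rewrite -!mulmxA -map_mxM mulmxV// map_mx1 !mulmx1 => /rowP e i.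
by have := e i; rewrite !mxE.
Qed.

(** The inverse of [T] is integral, so [- z] has integer coordinates in the basis of rows; by
    uniqueness they agree with the nonnegative real coordinates given by the cone. *)
Lemma coneP T z : T \in mesh -> cone T (- ivec z : 'rV[R]_d) ->
  exists n : 'I_d -> nat, z = - \sum_i row i T *+ n i.
Proof.
move=> Tm [r [x [r0 [/convP[a [a0 _ ->]]]]]].
rewrite scaler_sumr; under eq_bigr do rewrite scalerA.
pose m := - z *m invmx T.
have mE : - z = m *m T by rewrite mulmxKV// mesh_unit.
rewrite -ivecN mE ivec_mul => /(vtx_comb_inj Tm) mi.
exists (fun i => absz (m 0 i)); apply: oppr_inj; rewrite opprK mE mulmx_sum_row.
apply: eq_bigr => i _; rewrite -scaler_nat natz gez0_abs//.
by rewrite -(ler0z R) mi mulr_ge0.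
Qed.

Lemma mesh_cone z : exists2 T, T \in mesh & cone T (- ivec z : 'rV[R]_d).
Proof.
have [_ [[eps [eps0 nb]] _]] := hmesh.
set y : 'rV[R]_d := - ivec z; pose S := 1 + \sum_i `|y 0 i|.
have S0 : 0 < S by rewrite ltr_wpDr// sumr_ge0.
(* Since [S] exceeds every coordinate of [y] in absolute value, the scaled point falls in the
   neighborhood covered by the mesh. *)
have [i|T Tm Tx] := nb ((eps / S) *: y).
  rewrite mxE normrM ger0_norm ?divr_ge0 ?ltW// mulrAC ltr_pdivrMr// ltr_pM2l//.
  by rewrite /S (bigD1 i)//= addrCA ltrDl ltr_wpDr// sumr_ge0.
exists T => //; exists (S / eps), ((eps / S) *: y); split; first by rewrite divr_ge0 ?ltW.
by split => //; rewrite scalerA mulrA divfK ?divff ?scale1r// gt_eqF.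
Qed.

(** Only the diagonal term is kept; acuteness makes the others nonnegative. *)
Lemma inner_comb_ge T i (b : 'I_d -> R) : T \in mesh -> (forall j, 0 <= b j) ->
  b i * norm (vtx T i) ^+ 2 <= inner (\sum_j b j *: vtx T j) (vtx T i).
Proof.
move=> Tm b0; rewrite innerM_suml (bigD1 i)//= innerMZl sqr_normM// lerDl.
by apply: sumr_ge0 => j _; rewrite innerMZl mulr_ge0// mesh_acute.
Qed.

(** * Causality, comparison and the one-pass property for a real-valued solution *)

Section RealSolution.
Variable delta : 'rV[int]_d -> R.
Hypothesis delta_ge0 : forall z, 0 <= delta z.
Hypothesis delta_sol : is_solution M mesh (EFin \o delta).

Lemma solution_le z T a : z != 0 -> T \in mesh -> weights a ->
  delta z <= update_cost M delta z T a.
Proof.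
move=> z0 Tm wa; rewrite -lee_fin; have [_ /(_ z z0)] := delta_sol.
by move=> /= ->; exact: HopfLax_le_update.
Qed.

(** The best weights of each simplex exist by compactness, and the mesh is finite. *)
Lemma solution_attained z : z != 0 -> exists T a,
  [/\ T \in mesh, weights a & delta z = update_cost M delta z T a].
Proof.
move=> z0.
pose best T := proj1_sig (cid2 (update_cost_min hM delta z T d_gt0)).
have bestP T : weights (best T) /\ forall b, weights b ->
    update_cost M delta z T (best T) <= update_cost M delta z T b.
  by rewrite /best; case: cid2.
have [T0 T0m _] := mesh_cone 0.
have [T Tm Tmin] := seq_argmin (fun T => update_cost M delta z T (best T)) T0m.
exists T, (best T); split => //; first exact: (bestP T).1.
apply/eqP; rewrite eq_le solution_le//=; last exact: (bestP T).1.
rewrite -lee_fin; have [_ /(_ z z0) /= ->] := delta_sol.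
apply: HopfLax_ge => T' a T'm wa; rewrite lee_fin.
by apply: le_trans (Tmin _ T'm) _; exact: (bestP T').2.
Qed.

Section Minimizer.
Variables (z : 'rV[int]_d) (T : 'M[int]_d) (a : 'I_d -> R).
Hypotheses (z_neq0 : z != 0) (Tmesh : T \in mesh) (wa : weights a).
Hypothesis za : delta z = update_cost M delta z T a.
Let V := \sum_j a j *: vtx T j.

(** Homogeneity of the cost removes the normalization of the weights. The zero family is included:
    it occurs when all the mass sits on the vertex removed in [causality]. *)
Lemma minimizer_homogeneous (b : 'I_d -> R) : (forall j, 0 <= b j) ->
  (\sum_j b j) * delta z <=
    norm (\sum_j b j *: vtx T j) + \sum_j b j * delta (z + row j T).
Proof.
move=> b0; set s := \sum_j b j.
have s0 : 0 <= s by apply: sumr_ge0.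
have [sE|sn] := eqVneq s 0.
  by rewrite sE mul0r addr_ge0 ?normM_ge0// sumr_ge0// => j _; rewrite mulr_ge0.
have sp : 0 < s by rewrite lt_def sn.
have wb : weights (fun j => s^-1 * b j).
  split; first by move=> j; rewrite mulr_ge0 ?invr_ge0.
  by rewrite -mulr_sumr mulVf.
have := solution_le z_neq0 Tmesh wb.
rewrite /update_cost; under eq_bigr do rewrite -scalerA.
rewrite -scaler_sumr normMZ ?invr_ge0//.
under [X in _ + X]eq_bigr do rewrite -mulrA.
by rewrite -mulr_sumr -mulrDr mulrC ler_pdivlMr// mulrC.
Qed.

(* Compare the minimizer with the weights where the mass [a i] is removed. *)
Lemma causality i : a i != 0 ->
  a i * norm (vtx T i) ^+ 2 <= 2 * norm V * (delta z - delta (z + row i T)).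
Proof.
move=> ai; have [a0 a1] := wa.
have aip : 0 < a i by rewrite lt_def ai a0.
pose b j := if j == i then 0 else a j.
have b0 j : 0 <= b j by rewrite /b; case: ifP.
have := minimizer_homogeneous b0.
have split_sum (F : 'I_d -> R) : \sum_j b j * F j = \sum_j a j * F j - a i * F i.
  rewrite (bigD1 i)//= [in RHS](bigD1 i)//= /b eqxx mul0r add0r addrAC subrr add0r.
  by apply: eq_bigr => j /negPf ->.
have -> : \sum_j b j = 1 - a i.
  by have := split_sum (fun=> 1); rewrite !mulr1; under eq_bigr do rewrite mulr1;
     under [in RHS]eq_bigr do rewrite mulr1; rewrite a1.
rewrite split_sum.
have -> : \sum_j b j *: vtx T j = V - a i *: vtx T i.
  rewrite /V (bigD1 i)//= [in RHS](bigD1 i)//= /b eqxx scale0r add0r addrAC subrr add0r.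
  by apply: eq_bigr => j /negPf ->.
set W := V - _; move: za; rewrite /update_cost -/V => zE h.
(* Acuteness enters through [inner V (vtx T i) >= a i * norm (vtx T i) ^+ 2]. *)
have WV : norm W ^+ 2 + (a i * norm (vtx T i)) ^+ 2 <= norm V ^+ 2.
  have := inner_comb_ge i Tmesh a0; rewrite -/V => iV.
  rewrite exprMn !sqr_normM// /W.
  rewrite !(innerMDl, innerMDr hM, innerMNl, innerMNr hM, innerMZl, innerMZr hM).
  rewrite (innerMC hM _ V); move: iV; rewrite sqr_normM//.
  by set p := inner _ _; set q := inner _ _ => iV; nra.
have V0 := normM_ge0 M V; have W0 := normM_ge0 M W.
have h' : norm V - norm W <= a i * (delta z - delta (z + row i T)) by lra.
have WleV : norm W <= norm V.
  by rewrite -ler_sqr ?nnegrE//; apply: le_trans WV; rewrite lerDl sqr_ge0.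
rewrite -(ler_pM2l aip).
have -> : a i * (2 * norm V * (delta z - delta (z + row i T))) =
   2 * norm V * (a i * (delta z - delta (z + row i T))) by ring.
(* As [norm W <= norm V], the middle term is at least [norm V ^+ 2 - norm W ^+ 2]. *)
apply: le_trans (_ : 2 * norm V * (norm V - norm W) <= _).
  have := mulr_ge0 W0 (_ : 0 <= norm V - norm W).
  rewrite subr_ge0 => /(_ WleV).
  have : 0 <= (norm V - norm W) ^+ 2 by exact: sqr_ge0.
  nra.
by apply: ler_wpM2l => //; rewrite mulr_ge0.
Qed.

Lemma causality_lt i : a i != 0 -> delta (z + row i T) < delta z.
Proof.
move=> ai; have := causality ai.
have aip : 0 < a i by rewrite lt_def ai wa.1.
rewrite leNgt; apply: contraNT; rewrite -leNgt => le.
apply: le_lt_trans (_ : 0 < _).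
  by rewrite mulr_ge0_le0 ?subr_le0// mulr_ge0 ?normM_ge0.
by rewrite mulr_gt0 ?exprn_gt0// vtx_gt0.
Qed.

End Minimizer.

(** Some weight of a minimizer is at least [d%:R^-1]. Inserting it in [causality], with the shortest
    edge [pm] and the longest edge [pM] of the finite mesh, gives [eps]. *)
Lemma uniform_decrease : exists2 eps : R, 0 < eps &
  forall z, z != 0 -> exists T i, T \in mesh /\ delta (z + row i T) <= delta z - eps.
Proof.
pose ps := [seq (T, i) | T <- mesh, i <- enum 'I_d].
have psP T i : T \in mesh -> (T, i) \in ps.
  by move=> Tm; apply: allpairs_f; rewrite ?mem_enum.
have psm p : p \in ps -> p.1 \in mesh by case/allpairsP => -[? ?] [? _ ->].
have [T0 T0m _] := mesh_cone 0.
have p0 := psP T0 (Ordinal d_gt0) T0m.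
pose len (p : 'M[int]_d * 'I_d) : R := norm (vtx p.1 p.2).
have [pm /psm pmm minP] := seq_argmin len p0.
have [pM /psm pMm maxP] := seq_argmin (fun p => - len p) p0.
have lm : 0 < len pm by exact: vtx_gt0.
have lM : 0 < len pM by exact: vtx_gt0.
have dR : 0 < d%:R :> R by rewrite ltr0n.
exists (len pm ^+ 2 / d%:R / (2 * len pM)).
  by rewrite !divr_gt0 ?exprn_gt0 ?mulr_gt0.
move=> z z0; have [T [a [Tm wa za]]] := solution_attained z0.
have [i ai] : exists i, d%:R^-1 <= a i.
  apply: contrapT => /forallNP small; move: wa.2; apply/eqP; rewrite lt_eqF//.
  apply: lt_le_trans (_ : \sum_(i < d) d%:R^-1 <= _); last first.
    by rewrite sumr_const card_ord -[_ *+ d]mulr_natr mulVf ?gt_eqF.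
  apply: ltr_sum; last by move=> i _; rewrite ltNge; apply/negP.
  by apply/hasP; exists (Ordinal d_gt0); rewrite ?mem_index_enum.
have ai0 : 0 < a i by apply: lt_le_trans ai; rewrite invr_gt0.
exists T, i; split => //.
have causal := causality z0 Tm wa za (lt0r_neq0 ai0).
rewrite lerBrDr -lerBrDl ler_pdivrMr ?mulr_gt0//.
set V := \sum_j _ in causal.
have drop0 : 0 <= delta z - delta (z + row i T).
  by rewrite subr_ge0 ltW// (causality_lt z0 Tm wa za)// gt_eqF.
have Vle : norm V <= len pM.
  apply: le_trans (normM_comb hM _ wa.1) _.
  rewrite -[leRHS]mul1r -wa.2 mulr_suml; apply: ler_sum => j _.
  by rewrite ler_wpM2l ?wa.1// -lerN2 (maxP (T, j))// psP.
apply: le_trans (_ : a i * norm (vtx T i) ^+ 2 <= _).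
  rewrite mulrC; apply: ler_pM => //; first exact: sqr_ge0.
  by rewrite ler_pXn2r ?nnegrE ?normM_ge0 ?(ltW lm)// (minP (T, i))// psP.
apply: le_trans causal _; rewrite [leRHS]mulrC ler_wpM2r//.
by rewrite ler_pM2l.
Qed.

Lemma finite_sublevel b : exists s : seq 'rV[int]_d, forall z, delta z <= b -> z \in s.
Proof.
have [eps eps0 dec] := uniform_decrease.
pose ps := [seq row i T | T <- mesh, i <- enum 'I_d].
(* Every point is joined to 0 by a path of at most [delta z / eps] mesh edges. *)
pose reach := fix reach n :=
  if n is n'.+1 then reach n' ++ [seq y - v | y <- reach n', v <- ps] else [:: 0].
have reachP n : forall z, delta z <= n%:R * eps -> z \in reach n.
  elim: n => [|n IH] z zn /=.
    (* A non-zero point of value at most 0 would have a neighbor of negative value. *)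
    rewrite inE; apply/negPn/negP => /dec[T [i [_ le]]].
    have := delta_ge0 (z + row i T); move: zn; rewrite mul0r => zn ge0.
    suff : eps <= 0 by rewrite leNgt eps0.
    lra.
  rewrite mem_cat; have [->|/dec[T [i [Tm le]]]] := eqVneq z 0.
    by rewrite IH//; have [[->] _] := delta_sol; rewrite mulr_ge0 // ltW.
  apply/orP; right; apply/allpairsP; exists (z + row i T, row i T); rewrite addrK.
  split => //=; last by apply: allpairs_f; rewrite ?mem_enum.
  by apply: IH; move: zn; rewrite -natr1 mulrDl; lra.
exists (reach (Num.bound (`|b| / eps))) => z zb; apply: reachP.
have := archi_boundP (divr_ge0 (normr_ge0 b) (ltW eps0)).
rewrite ltr_pdivrMr// => /ltW; apply: le_trans.
exact: le_trans zb (ler_norm _).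
Qed.

(** By causality the points carrying weight in a minimizer have smaller values, and finite sublevel
    sets make this descent well founded. *)
Lemma solution_induction (P : 'rV[int]_d -> Prop) : P 0 ->
  (forall z T a, z != 0 -> T \in mesh -> weights a ->
     delta z = update_cost M delta z T a ->
     (forall i, a i != 0 -> P (z + row i T)) -> P z) ->
  forall z, P z.
Proof.
move=> P0 Pind; apply: (sublevel_induction finite_sublevel) => z IH.
have [->//|z0] := eqVneq z 0.
have [T [a [Tm wa za]]] := solution_attained z0.
by apply: (Pind z T a) => // i ai; apply: IH; exact: causality_lt za _ ai.
Qed.

(** The subsolution is tested with the minimizer of [delta]: points carrying weight are covered by
    induction, the others contribute zero. *)
Lemma comparison (w : 'rV[int]_d -> R) : w 0 <= 0 ->
  (forall z T a, z != 0 -> T \in mesh -> weights a -> w z <= update_cost M w z T a) ->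
  forall z, w z <= delta z.
Proof.
move=> w0 wsub; apply: solution_induction.
  by have [[->] _] := delta_sol.
move=> z T a z0 Tm wa -> IH; apply: le_trans (wsub z T a z0 Tm wa) _.
rewrite lerD2l; apply: ler_sum => i _.
have [->|ai] := eqVneq (a i) 0; first by rewrite !mul0r.
by rewrite ler_wpM2l ?wa.1// IH.
Qed.

(** The norm is a subsolution: [z] is the average of the points [z + row i T] minus the average
    edge, and the norm is convex. *)
Lemma solution_ge_norm z : norm (ivec z) <= delta z.
Proof.
apply: (comparison (w := fun z => norm (ivec z))); first by rewrite ivec0 normM0.
move=> {}z T a z0 Tm [a0 a1].
have zE : ivec z = \sum_i a i *: ivec (z + row i T) - \sum_i a i *: vtx T i.
  rewrite -sumrB -[LHS]scale1r -a1 scaler_suml; apply: eq_bigr => i _.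
  by rewrite -scalerBr ivecD addrK.
rewrite [in leLHS]zE addrC; apply: le_trans (normMD hM _ _) _.
by rewrite (normMN hM) lerD2l normM_comb.
Qed.

(** Unfixed points only raise the update. At [sigma n] the points carrying weight in a minimizer
    have smaller values, hence are already fixed, so the true value is recovered. *)
Lemma solution_one_pass : fast_marching_one_pass M mesh (EFin \o delta).
Proof.
have [|sigma sigmab incr] := @increasing_enumeration _ _ _ finite_sublevel
    (fun n : nat => const_mx n%:Z).
  by move=> m n /rowP/(_ (Ordinal d_gt0)); rewrite !mxE => -[].
have [tau sigmaK tauK] := sigmab.
have [delta0 deltaE] := delta_sol.
have sigma0 : sigma 0%N = 0.
  apply/eqP/negPn/negP => s0; have [eps eps0 dec] := uniform_decrease.
  have [T [i [_ le]]] := dec _ s0.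
  have := (incr 0%N (tau 0)).2 isT; rewrite tauK; case: delta0 => ->.
  have ge0 := delta_ge0 (sigma 0%N + row i T) => le0.
  suff : eps <= 0 by rewrite leNgt eps0.
  lra.
exists sigma; split => //; split => // n n0.
have sn m : (n <= m)%N -> sigma m != 0.
  move=> nm; apply/eqP; rewrite -sigma0 => /(can_inj sigmaK) m0.
  by move: n0; rewrite leqNgt ltnS -m0 nm.
have fixed_ge y : ((EFin \o delta) y <= fixed_before sigma n (EFin \o delta) y)%E.
  by rewrite /fixed_before; case: ifP => // _; rewrite leey.
have ge m : (n <= m)%N ->
    ((EFin \o delta) (sigma m) <=
      HopfLax M mesh (fixed_before sigma n (EFin \o delta)) (sigma m))%E.
  by move=> /sn/deltaE ->; exact: le_HopfLax.
split; last first.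
  by move=> m nm; apply: le_trans (ge m nm); rewrite lee_fin (incr n m).2.
apply/eqP; rewrite eq_le ge//=.
have [T [a [Tm wa za]]] := solution_attained (sn n (leqnn n)).
apply: le_trans (HopfLax_le_cost _ _ _ Tm wa) _.
rewrite za /update_cost EFinD leeD2l// -sumEFin lee_sum// => i _.
(* Points without weight may still be unfixed; their infinite value is annihilated by the zero
   weight. *)
have [->|ai] := eqVneq (a i) 0; first by rewrite mul0e mul0r.
rewrite /fixed_before ifT ?EFinM//.
rewrite -[X in X \in _]tauK map_f// mem_iota leq0n add0n/=.
apply: (incr _ _).1; rewrite tauK.
exact: causality_lt (sn n (leqnn n)) Tm wa za _ ai.
Qed.

End RealSolution.

Lemma solution_unique (delta delta' : 'rV[int]_d -> R) :
  (forall z, 0 <= delta z) -> is_solution M mesh (EFin \o delta) ->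
  (forall z, 0 <= delta' z) -> is_solution M mesh (EFin \o delta') -> delta = delta'.
Proof.
move=> d0 ds d'0 d's; apply/funext => z; apply/eqP; rewrite eq_le; apply/andP; split.
  apply: comparison => //; first by have [[->]] := ds.
  by move=> y T a; exact: solution_le.
apply: comparison => //; first by have [[->]] := d's.
by move=> y T a; exact: solution_le.
Qed.

End ReducedMesh.

(** * Existence and error bound *)

Section FixedPoint.
Variables (R : realType) (d : nat) (M : 'M[R]_d) (mesh : seq 'M[int]_d).
Hypotheses (d_gt0 : (0 < d)%N) (hM : sym_posdef M) (hmesh : M_reduced M mesh).
Local Notation inner := (innerM M).
Local Notation norm := (normM M).
Local Notation vtx T i := (ivec (row i T) : 'rV[R]_d).
Implicit Types (T : 'M[int]_d) (z : 'rV[int]_d).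

(* Knaster-Tarski: the pointwise infimum of the supersolutions. *)
Lemma solution_exists : exists delta : 'rV[int]_d -> \bar R,
  (forall z, 0 <= delta z)%E /\ is_solution M mesh delta.
Proof.
pose F (w : 'rV[int]_d -> \bar R) z := if z == 0 then 0%E else HopfLax M mesh w z.
have F_mono w w' : (forall z, w z <= w' z)%E -> forall z, (F w z <= F w' z)%E.
  by move=> le z; rewrite /F; case: ifP => // _; exact: le_HopfLax.
pose super w := forall z, (0 <= w z)%E /\ (F w z <= w z)%E.
pose delta z : \bar R := ereal_inf [set w z | w in super].
have delta_le w : super w -> forall z, (delta z <= w z)%E.
  by move=> sw z; apply: ereal_inf_lbound; exists w.
have delta0 z : (0 <= delta z)%E.
  by apply: le_ereal_inf_tmp => _ [w sw <-]; exact: (sw z).1.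
have Fdelta z : (F delta z <= delta z)%E.
  apply: le_ereal_inf_tmp => _ [w sw <-]; apply: le_trans (sw z).2.
  exact/F_mono/delta_le.
(* By monotonicity [F delta] is itself a supersolution, so the infimum lies below it. *)
have deltaF z : (delta z <= F delta z)%E.
  apply: delta_le => {}z; split; last exact: F_mono.
  by rewrite /F; case: ifP => // _; exact: HopfLax_ge0.
have deltaE z : delta z = F delta z by apply/eqP; rewrite eq_le deltaF Fdelta.
exists delta; split => //; split; first by rewrite deltaE /F eqxx.
by move=> z z0; rewrite {1}deltaE /F (negPf z0).
Qed.

(** Induction on [\sum_i n i]: adding [row i T] lowers [n i] by one and stays in the opposite
    cone. *)
Lemma cone_induction T (P : 'rV[int]_d -> Prop) : P 0 ->
  (forall z (n : 'I_d -> nat), z != 0 -> z = - \sum_i row i T *+ n i ->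
     (forall i, (0 < n i)%N -> P (z + row i T)) -> P z) ->
  forall n : 'I_d -> nat, P (- \sum_i row i T *+ n i).
Proof.
move=> P0 Pind n; move: {2}(\sum_i n i)%N (leqnn (\sum_i n i)%N) => N.
elim: N n => [|N IH] n nN.
  rewrite big1 ?oppr0// => i _; suff -> : n i = 0%N by [].
  by apply/eqP; rewrite -leqn0 (leq_trans _ nN)// (bigD1 i)//= leq_addr.
set z := - _; have [->//|z0] := eqVneq z 0.
apply: (Pind z n) => // i ni.
pose n' j := (n j - (j == i))%N.
have -> : z + row i T = - \sum_j row j T *+ n' j.
  rewrite /z (bigD1 i)//= [in RHS](bigD1 i)//= /n' eqxx.
  under [in RHS]eq_bigr => j /negPf -> do rewrite subn0.
  by rewrite -{1}(subnK ni) mulrnDr mulr1n addrAC opprD subrK.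
apply: IH; rewrite -ltnS; apply: leq_trans nN.
rewrite (bigD1 i)//= [ltnRHS](bigD1 i)//= /n' eqxx.
under eq_bigr => j /negPf -> do rewrite subn0.
by rewrite ltn_add2r subn1 prednK.
Qed.

(** Putting all the weight on one vertex bounds [delta z] by an edge length plus the value one step
    closer to the origin in the cone. *)
Lemma solution_fin (delta : 'rV[int]_d -> \bar R) :
  (forall z, 0 <= delta z)%E -> is_solution M mesh delta ->
  exists2 delta' : 'rV[int]_d -> R, (forall z, 0 <= delta' z) & delta = EFin \o delta'.
Proof.
move=> delta0 [deltaz deltaE].
have fin z : delta z \is a fin_num.
  rewrite ge0_fin_numE//.
  have [T Tm /(coneP hmesh Tm)[n ->]] := mesh_cone hmesh z.
  apply: (cone_induction (P := fun z => (delta z < +oo)%E)); first by rewrite deltaz.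
  move=> {n}z n z0 zn IH.
  have [i ni] : exists i, (0 < n i)%N.
    apply: contrapT => /forallNP n0; move/eqP: z0; apply; rewrite zn big1 ?oppr0// => i _.
    by have /negP := n0 i; rewrite lt0n negbK => /eqP ->.
  pose a (j : 'I_d) : R := (j == i)%:R.
  have wa : weights a.
    split; first by move=> j; rewrite /a.
    by rewrite (bigD1 i)//= /a eqxx big1 ?addr0// => j /negPf ->.
  rewrite deltaE//; apply: le_lt_trans (HopfLax_le_cost _ _ _ Tm wa) _.
  rewrite lte_add_pinfty ?ltry// (bigD1 i)//= big1 ?adde0 /a ?eqxx ?mul1e ?IH//.
  by move=> j /negPf ->; rewrite mul0e.
exists (fine \o delta); first by move=> z; exact: fine_ge0.
by apply/funext => z /=; rewrite fineK.
Qed.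

(** * Upper bound in one cone, for a bound [r] on edge lengths and a bound [S] on squared sines *)

Section ErrorBound.
Variable delta : 'rV[int]_d -> R.
Hypothesis delta_ge0 : forall z, 0 <= delta z.
Hypothesis delta_sol : is_solution M mesh (EFin \o delta).
Variables (T : 'M[int]_d) (r S : R).
Hypotheses (Tm : T \in mesh) (r_gt0 : 0 < r) (S_ge0 : 0 <= S).
Hypothesis vtx_le : forall i, norm (vtx T i) <= r.
Hypothesis gram : forall i (b : 'I_d -> R), (forall j, 0 <= b j) ->
  let w := \sum_j b j *: vtx T j in
  norm (vtx T i) ^+ 2 * norm w ^+ 2 - inner (vtx T i) w ^+ 2 <=
    S * (norm (vtx T i) ^+ 2 * norm w ^+ 2).
Let bound z := norm (ivec z) + d%:R * S * r * potential (norm (ivec z) / r).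

(* At [z = - \sum_i n_i v_i] with [N = \sum_i n_i], the update with weights [n_i / N]
   moves along a straight line towards the origin. *)
Lemma solution_le_bound (n : 'I_d -> nat) :
  let z := - \sum_i row i T *+ n i in delta z <= bound z.
Proof.
apply: (cone_induction (P := fun z => delta z <= bound z)).
  have [[->] _] := delta_sol.
  by rewrite /bound ivec0 normM0 add0r mul0r !mulr_ge0 ?ler0n ?potential_ge0 // ltW.
move=> {n}z n z0 zn IH.
set D := norm (ivec z); pose y := \sum_i (n i)%:R *: vtx T i.
have yE : ivec z = - y.
  by rewrite zn ivecN ivec_sum; congr (- _); apply: eq_bigr => i _; rewrite ivecMn.
have Dy : norm y = D by rewrite /D yE normMN.
have D0 : 0 < D by rewrite /D normM_gt0// ivec_eq0.
pose N : R := \sum_i (n i)%:R.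
have N0 : 0 < N.
  rewrite lt_def sumr_ge0 ?andbT//; apply/eqP => /psumr_eq0P N0.
  move: D0; rewrite -Dy /y big1 ?normM0 ?ltxx// => i _.
  by rewrite N0 ?scale0r.
pose a i := (n i)%:R / N.
have wa : weights a.
  by split; [move=> i; rewrite divr_ge0// ltW|rewrite -mulr_suml divff ?gt_eqF].
have VE : norm (\sum_i a i *: vtx T i) = D / N.
  rewrite -Dy mulrC -(normMZ hM) ?invr_ge0 ?(ltW N0)// /y scaler_sumr; congr (norm _).
  by apply: eq_bigr => i _; rewrite scalerA mulrC.
pose q i := inner y (vtx T i); pose v i := norm (vtx T i).
have v0 i : 0 <= v i by exact: normM_ge0.
have nq i : (n i)%:R * v i ^+ 2 <= q i.
  exact: (inner_comb_ge hM hmesh i Tm (b := fun j => (n j)%:R)).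
have q0 i : 0 <= q i by apply: le_trans (nq i); rewrite mulr_ge0 ?exprn_ge0.
have qv i : q i <= v i * D by rewrite mulrC -Dy; exact: innerM_le.
(* To first order, moving by vertex [i] shortens the distance by [q i / D]; on average this is
   exactly the length of the step. *)
have aq : \sum_i a i * (q i / D) = D / N.
  have : \sum_i (n i)%:R * q i = D ^+ 2.
    by rewrite -Dy sqr_normM// {1}/y innerM_sumr//; apply: eq_bigr => i _; rewrite innerMZr.
  move=> e; have -> : D / N = D ^+ 2 / (N * D) by field; rewrite !gt_eqF.
  rewrite -e mulr_suml; apply: eq_bigr => i _.
  by rewrite /a; field; rewrite !gt_eqF.
(* [kappa] is the slope of the concave part of [bound], as a function of [D]. *)
pose m := Num.min 1 (D / r)^-1; pose kappa := d%:R * S * m.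
have m0 : 0 <= m by rewrite le_min ler01 invr_ge0 divr_ge0 ?ltW.
have k0 : 0 <= kappa by rewrite !mulr_ge0.
have DN0 : 0 <= D / N by rewrite divr_ge0 ?ltW.
(* The second-order excess of the new distance over [D - q i / D], times the slope [1 + kappa] of
   [bound]. *)
pose X i := (1 + kappa) * (norm (ivec (z + row i T)) - D + q i / D).
have excess i : (0 < n i)%N ->
    X i <= (1 + kappa) * (q i / D / 2) /\ X i <= (1 + kappa) * (S * v i ^+ 2 / D / 2).
  move=> ni; have k1 : 0 <= 1 + kappa by rewrite addr_ge0.
  (* These are the cone coordinates of [- (z + row i T)], nonnegative because [n i] is positive. *)
  pose b j := (n j)%:R - (j == i)%:R : R.
  have b0 j : 0 <= b j.
    by rewrite /b subr_ge0 ler_nat; case: eqP => // ->.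
  pose w := \sum_j b j *: vtx T j.
  have wE : w = y - vtx T i.
    rewrite /w; under eq_bigr do rewrite scalerBl; rewrite sumrB; congr (_ - _).
    by rewrite (bigD1 i)//= eqxx scale1r big1 ?addr0// => j /negPf ->; rewrite scale0r.
  have D'E : norm (ivec (z + row i T)) = norm w.
    by rewrite ivecD yE wE -(normMN hM) opprD opprK.
  have w2 : norm w ^+ 2 = D ^+ 2 - 2 * q i + v i ^+ 2.
    rewrite -Dy !sqr_normM// wE !(innerMDl, innerMDr hM, innerMNl, innerMNr hM).
    by rewrite (innerMC hM (vtx T i) y) -/(q i); ring.
  have vw : inner (vtx T i) w = q i - v i ^+ 2.
    by rewrite wE innerMDr// innerMNr// sqr_normM// (innerMC hM _ y).
  have n1 : (1 : R) <= (n i)%:R by rewrite ler1n.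
  have [|||c1 c2] :=
    @triangle_excess _ D (norm w) (v i) (q i) S D0 (normM_ge0 M w) (v0 i) S_ge0 w2.
  - by apply: le_trans (nq i); rewrite ler_peMl ?sqr_ge0.
  - exact: qv.
  - have := gram i b0; rewrite /= -/w -/(v i) vw => g.
    by apply: le_trans g; rewrite w2 le_eqVlt; apply/orP; left; apply/eqP; ring.
  by rewrite /X D'E; split; rewrite ler_wpM2l.
(* Here [m * D] is the minimum of [D] and [r]. *)
have vm i : (0 < n i)%N -> v i <= m * D.
  move=> ni; rewrite /m minr_pMl ?(ltW D0)// mul1r invf_div divfK ?gt_eqF//.
  rewrite le_min vtx_le andbT.
  have [->|vn] := eqVneq (v i) 0; first exact: ltW.
  have vp : 0 < v i by rewrite lt_def vn v0.
  rewrite -(ler_pM2l vp); apply: le_trans (qv i); apply: le_trans (nq i).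
  by rewrite -expr2 ler_peMl ?sqr_ge0// ler1n.
have nv i : (n i)%:R * v i <= D.
  have [vi|vn] := eqVneq (v i) 0; first by rewrite vi mulr0 ltW.
  have vp : 0 < v i by rewrite lt_def vn v0.
  by rewrite -(ler_pM2l vp) mulrCA -expr2; exact: le_trans (nq i) (qv i).
(* If [1 <= kappa], then [(1 + kappa) / 2 <= kappa] and the first estimate suffices. Otherwise
   [(1 + kappa) / 2 <= 1], and the second bounds each of the [d] terms by [S * m * (D / N)]; this is
   where the dimension enters. *)
have sumX : \sum_i a i * X i <= kappa * (D / N).
  have [k1|k1] := leP 1 kappa.
    rewrite -aq mulr_sumr; apply: ler_sum => i _.
    have [ni|] := posnP (n i); first by rewrite /a ni !mul0r mulr0.
    move=> /excess[h _]; rewrite [leRHS]mulrCA ler_wpM2l ?wa.1//; apply: le_trans h _.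
    have : 0 <= q i / D by rewrite divr_ge0// ltW.
    by nra.
  have -> : kappa * (D / N) = \sum_(i < d) S * m * (D / N).
    by rewrite sumr_const card_ord -[RHS]mulr_natl /kappa; ring.
  apply: ler_sum => i _.
  have [ni|ni] := posnP (n i); first by rewrite /a ni !mul0r mulr_ge0 // mulr_ge0.
  have [_ h] := excess i ni.
  apply: le_trans (_ : a i * (S * m * v i) <= _).
    rewrite ler_wpM2l ?wa.1//; apply: le_trans h _.
    apply: le_trans (_ : S * v i ^+ 2 / D <= _).
      have : 0 <= S * v i ^+ 2 / D by rewrite divr_ge0 ?mulr_ge0 ?sqr_ge0// ltW.
      by nra.
    rewrite ler_pdivrMr// -!mulrA ler_wpM2l// expr2 [leRHS]mulrA mulrAC.
    by rewrite ler_wpM2r ?vm.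
  have -> : a i * (S * m * v i) = S * m * ((n i)%:R * v i / N) by rewrite /a; ring.
  by rewrite ler_wpM2l ?mulr_ge0// ler_wpM2r ?invr_ge0 ?(ltW N0).
apply: le_trans (solution_le delta_sol z0 Tm wa) _.
rewrite /update_cost VE.
(* The induction hypothesis is combined with the tangent inequality for [potential] at [D / r]. *)
have term i : a i * delta (z + row i T) <=
    a i * (bound z) + a i * X i - (1 + kappa) * (a i * (q i / D)).
  have [ni|ni] := posnP (n i); first by rewrite /a ni !mul0r mulr0 subr0 addr0.
  have -> : a i * bound z + a i * X i - (1 + kappa) * (a i * (q i / D)) =
      a i * (bound z + X i - (1 + kappa) * (q i / D)) by ring.
  rewrite ler_wpM2l ?wa.1//; apply: le_trans (IH i ni) _.
  rewrite /bound -/D /X; set D' := norm _.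
  have tangent : potential (D' / r) <= potential (D / r) + m * (D' / r - D / r).
    by apply: potential_tangent; rewrite ?divr_gt0// divr_ge0 ?normM_ge0 ?ltW.
  have C0 : 0 <= d%:R * S * r by rewrite !mulr_ge0// ltW.
  have := ler_wpM2l C0 tangent.
  have -> : d%:R * S * r * (potential (D / r) + m * (D' / r - D / r)) =
      d%:R * S * r * potential (D / r) + kappa * (D' - D).
    by rewrite /kappa; field; rewrite gt_eqF.
  by lra.
(* Step length, excess and first-order gain cancel exactly. *)
apply: le_trans (_ : D / N + (bound z + kappa * (D / N) - (1 + kappa) * (D / N)) <= _);
  last by lra.
rewrite lerD2l; apply: le_trans (ler_sum _ (fun i _ => term i)) _.
by rewrite sumrB big_split/= -mulr_suml wa.2 mul1r -mulr_sumr aq lerD2r lerD2l.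
Qed.

Lemma solution_error z : cone T (- ivec z : 'rV[R]_d) ->
  0 <= delta z - norm (ivec z) <= d%:R * S * r * (1 + lnplus (norm (ivec z) / r)).
Proof.
move=> /(coneP hmesh Tm)[n zn]; rewrite subr_ge0.
rewrite (solution_ge_norm d_gt0 hM hmesh delta_ge0 delta_sol).
have := solution_le_bound n; rewrite /= -zn /bound => h.
rewrite lerBlDl; apply: le_trans h _; rewrite lerD2l ler_wpM2l ?mulr_ge0 ?(ltW r_gt0)//.
by rewrite potential_le// divr_ge0 ?normM_ge0 ?ltW.
Qed.

End ErrorBound.

(** * Radius and angle of a simplex *)

Lemma vtx_simplex T i : simplex T (vtx T i).
Proof.
apply/convP; exists (fun j => (j == i)%:R); split => //.
  by rewrite (bigD1 i)//= eqxx big1 ?addr0// => j /negPf ->.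
by rewrite (bigD1 i)//= eqxx scale1r big1 ?addr0// => j /negPf ->; rewrite scale0r.
Qed.

Lemma vtx_le_rM T i : norm (vtx T i) <= rM_simplex M T.
Proof.
apply: ub_le_sup; last by exists (vtx T i) => //; exact: vtx_simplex.
exists (\sum_j norm (vtx T j)) => _ [x /convP[a [a0 a1 ->]] <-].
apply: le_trans (normM_comb hM _ a0) _; apply: ler_sum => j _.
rewrite ler_piMl ?normM_ge0//; apply: le_trans a1.
by rewrite (bigD1 j)//= lerDl sumr_ge0.
Qed.

Lemma rM_simplex_gt0 T : T \in mesh -> 0 < rM_simplex M T.
Proof.
move=> Tm; apply: lt_le_trans (vtx_le_rM T (Ordinal d_gt0)).
exact: (vtx_gt0 hM hmesh).
Qed.

Lemma rM_simplex_le_mesh T : T \in mesh -> rM_simplex M T <= rM_mesh M mesh.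
Proof. by move=> Tm; exact: le_bigmax_seq. Qed.

Lemma comb_inner_ge0 T (b c : 'I_d -> R) : T \in mesh ->
  (forall i, 0 <= b i) -> (forall i, 0 <= c i) ->
  0 <= inner (\sum_i b i *: vtx T i) (\sum_i c i *: vtx T i).
Proof.
move=> Tm b0 c0; rewrite innerM_suml sumr_ge0// => i _.
rewrite innerMZl mulr_ge0// innerM_sumr// sumr_ge0// => j _.
by rewrite innerMZr// mulr_ge0// (mesh_acute hmesh).
Qed.

Let cosines T := [set c | exists u v, [/\ simplex T u, u != 0, simplex T v, v != 0 &
  c = inner u v / (norm u * norm v)]].

Let cosines_ge0 T : T \in mesh -> lbound (cosines T) 0.
Proof.
move=> Tm _ [u [v [/convP[b [b0 _ ->]] _ /convP[c [c0 _ ->]] _ ->]]].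
by rewrite divr_ge0 ?comb_inner_ge0// mulr_ge0 ?normM_ge0.
Qed.

Let cosines1 T : T \in mesh -> cosines T 1.
Proof.
move=> Tm; have v0 := vtx_neq0 hmesh (Ordinal d_gt0) Tm.
exists (vtx T (Ordinal d_gt0)), (vtx T (Ordinal d_gt0)).
split => //; try exact: vtx_simplex.
by rewrite -expr2 sqr_normM// divff// gt_eqF// innerM_gt0.
Qed.

Lemma cos_thetaM_bounds T : T \in mesh -> 0 <= cos_thetaM M T <= 1.
Proof.
move=> Tm; apply/andP; split.
  by apply: lb_le_inf; [exists 1; exact: cosines1|exact: cosines_ge0].
by apply: ge_inf; [exists 0; exact: cosines_ge0|exact: cosines1].
Qed.

(** The cosine is invariant under positive scaling, so non-zero vectors of the cone can be shrunk or
    stretched into the simplex. *)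
Lemma cos_thetaM_le T (b c : 'I_d -> R) : T \in mesh ->
  (forall i, 0 <= b i) -> (forall i, 0 <= c i) ->
  let u := \sum_i b i *: vtx T i in let w := \sum_i c i *: vtx T i in
  cos_thetaM M T * (norm u * norm w) <= inner u w.
Proof.
move=> Tm b0 c0 /=; set u := \sum_i b i *: _; set w := \sum_i c i *: _.
have [->|u0] := eqVneq u 0; first by rewrite normM0 mul0r mulr0 innerM0l.
have [->|w0] := eqVneq w 0; first by rewrite normM0 !mulr0 innerMC// innerM0l.
have normalize (e : 'I_d -> R) : (forall i, 0 <= e i) -> \sum_i e i *: vtx T i != 0 ->
    exists2 s, 0 < s & simplex T (s *: \sum_i e i *: vtx T i).
  move=> e0 en; pose s := \sum_i e i.
  have s0 : 0 < s.
    rewrite lt_def sumr_ge0// andbT; apply: contraNneq en => /psumr_eq0P s0.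
    by rewrite big1// => i _; rewrite s0// scale0r.
  exists s^-1; first by rewrite invr_gt0.
  apply/convP; exists (fun i => s^-1 * e i); split.
  - by move=> i; rewrite mulr_ge0// invr_ge0 ltW.
  - by rewrite -mulr_sumr mulVf// gt_eqF.
  - by rewrite scaler_sumr; apply: eq_bigr => i _; rewrite scalerA.
have [s s0 us] := normalize b b0 u0; have [t t0 wt] := normalize c c0 w0.
rewrite -ler_pdivlMr ?mulr_gt0 ?normM_gt0//.
apply: ge_inf; first by exists 0; exact: cosines_ge0.
exists (s *: u), (t *: w); split => //;
  rewrite ?scaler_eq0 ?negb_or ?u0 ?w0 ?andbT ?lt0r_neq0//.
rewrite !normMZ ?ltW// innerMZl innerMZr//.
by field; rewrite !lt0r_neq0 ?normM_gt0.
Qed.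

Lemma sqr_sin_thetaM T : T \in mesh -> sin (thetaM M T) ^+ 2 = 1 - cos_thetaM M T ^+ 2.
Proof.
move=> /cos_thetaM_bounds/andP[c0 c1]; rewrite /thetaM sin_acos; last by lra.
by rewrite sqr_sqrtr// subr_ge0 expr_le1.
Qed.

(** The square of [cos_thetaM_le]; squaring is legitimate because acuteness makes the cosine
    nonnegative. *)
Lemma gram_sin T i (b : 'I_d -> R) : T \in mesh -> (forall j, 0 <= b j) ->
  let w := \sum_j b j *: vtx T j in
  norm (vtx T i) ^+ 2 * norm w ^+ 2 - inner (vtx T i) w ^+ 2 <=
    sin (thetaM M T) ^+ 2 * (norm (vtx T i) ^+ 2 * norm w ^+ 2).
Proof.
move=> Tm b0 /=; set w := \sum_j b j *: _.
rewrite sqr_sin_thetaM// mulrBl mul1r lerB// -!exprMn.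
have vE : vtx T i = \sum_j (j == i)%:R *: vtx T j.
  by rewrite (bigD1 i)//= eqxx scale1r big1 ?addr0// => j /negPf ->; rewrite scale0r.
have /andP[c0 _] := cos_thetaM_bounds Tm.
have /= h := @cos_thetaM_le T (fun j => (j == i)%:R) b Tm (fun j => ler0n _ _) b0.
rewrite -vE -/w in h.
rewrite ler_pXn2r ?nnegrE ?mulr_ge0 ?normM_ge0//.
by apply: le_trans h; rewrite !mulr_ge0 ?normM_ge0.
Qed.

End FixedPoint.

Theorem theorem1 (R : realType) (d : nat) (hd : (1 <= d)%N)
    (M : 'M[R]_d) (mesh : seq 'M[int]_d)
    (hM : sym_posdef M) (hmesh : M_reduced M mesh) :
  exists deltaM : 'rV[int]_d -> R,
    [/\ (forall z, 0 <= deltaM z) /\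
        is_solution M mesh (fun z => (deltaM z)%:E),
        (forall delta : 'rV[int]_d -> \bar R,
            (forall z, (0 <= delta z)%E) -> is_solution M mesh delta ->
            delta = (fun z => (deltaM z)%:E)),
        fast_marching_one_pass M mesh (fun z => (deltaM z)%:E),
        (forall z, 0 <= deltaM z - normM M (ivec (R:=R) z) <=
           d%:R * rM_mesh M mesh *
             (1 + lnplus (normM M (ivec (R:=R) z) / rM_mesh M mesh))) &
        (forall z T, T \in mesh -> cone T (- ivec (R:=R) z) ->
           0 <= deltaM z - normM M (ivec (R:=R) z) <=
           d%:R * (sin (thetaM M T)) ^+ 2 * rM_simplex M T *
             (1 + lnplus (normM M (ivec (R:=R) z) / rM_simplex M T)))].
Proof.
have [delta0 [delta0_ge0 delta0_sol]] := solution_exists M mesh.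
have [delta delta_ge0 deltaE] := solution_fin hmesh delta0_ge0 delta0_sol.
have delta_sol : is_solution M mesh (EFin \o delta) by rewrite -deltaE.
exists delta; split => //.
- move=> eta eta_ge0 eta_sol.
  have [eta' eta'_ge0 etaE] := solution_fin hmesh eta_ge0 eta_sol.
  rewrite etaE (solution_unique hd hM hmesh eta'_ge0 _ delta_ge0 delta_sol)//.
  by rewrite -etaE.
- exact: solution_one_pass.
- move=> z; have [T Tm zT] := mesh_cone hmesh z.
  (* The global bound is the instance [S = 1], where the Gram inequality only says that a square is
     nonnegative. *)
  rewrite -[d%:R]mulr1; apply: (solution_error hd hM hmesh delta_ge0 delta_sol Tm) => //.
  + exact: lt_le_trans (rM_simplex_gt0 hd hM hmesh Tm) (rM_simplex_le_mesh M Tm).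
  + by move=> i; apply: le_trans (vtx_le_rM hM T i) (rM_simplex_le_mesh M Tm).
  + by move=> i b b0 /=; rewrite mul1r gerBl sqr_ge0.
- move=> z T Tm zT; apply: (solution_error hd hM hmesh delta_ge0 delta_sol Tm) => //.
  + exact: (rM_simplex_gt0 hd hM hmesh Tm).
  + exact: sqr_ge0.
  + exact: vtx_le_rM.
  + by move=> i b b0; exact: (gram_sin hd hM hmesh).
Qed.
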